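(* Let $\beta:A\to B$ be a morphism of $R$-algebras, $\mathcal{T}$ an $A$-ring, $\mathcal{S}$ a $B$-ring and $\xi:\mathcal{S}\to\mathcal{T}$ a morphism of $A$-rings. Let $K$ be a right $\mathcal{T}$-module, $L$ a right $\mathcal{S}$-module, and assume that the right $\mathcal{S}$-module $K\otimes_A B$ is $L$-subgenerated. Then $(-\otimes_A B,\ \mathrm{Coind}_L^K(-))$ is an adjoint pair of covariant functors between $\sigma[K_{\mathcal{T}}]$ and $\sigma[L_{\mathcal{S}}]$, i.e. $-\otimes_A B:\sigma[K_{\mathcal{T}}]\to\sigma[L_{\mathcal{S}}]$ is left adjoint to $$\mathrm{Coind}_L^K(-):\sigma[L_{\mathcal{S}}]\to\sigma[K_{\mathcal{T}}],\quad N\mapsto\mathrm{Sp}\big(\sigma[K_{\mathcal{T}}],\mathrm{Hom}_{-\mathcal{S}}(\mathcal{T}\otimes_A B,N)\big).$$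
   Context: $R$ is a commutative ring with $1_R\neq 0_R$; $A$, $B$ are arbitrary $R$-algebras. $B$-modules are regarded as $A$-modules through $\beta$. An $A$-ring is an $A$-bimodule $\mathcal{T}$ with $A$-bilinear maps $\mu_{\mathcal{T}}:\mathcal{T}\otimes_A\mathcal{T}\to\mathcal{T}$ and $\eta_{\mathcal{T}}:A\to\mathcal{T}$ satisfying the associativity and unit axioms; a morphism of $A$-rings is an $A$-bilinear map compatible with multiplications and units. The $B$-ring $\mathcal{S}$ is regarded as an $A$-ring through $\beta$. $\mathbb{M}_{\mathcal{T}}$ is the category of right $\mathcal{T}$-modules; $\mathrm{Hom}_{-\mathcal{S}}$ denotes right $\mathcal{S}$-linear maps. Induced module: as part of the setting, for every right $\mathcal{T}$-module $M$ (in particular for $M=\mathcal{T}$) the right $B$-module $M\otimes_A B$ is taken as a right $\mathcal{S}$-module through $(\sum m_i\otimes_A b_i)\leftharpoonup s:=\sum m_i\xi(s)\otimes_A b_i$; this gives a functor $-\otimes_A B:\mathbb{M}_{\mathcal{T}}\to\mathbb{M}_{\mathcal{S}}$. When $K\otimes_A B$ is $L$-subgenerated this functor restricts to $\sigma[K_{\mathcal{T}}]\to\sigma[L_{\mathcal{S}}]$. For a right $\mathcal{S}$-module $N$, $\mathrm{Hom}_{-\mathcal{S}}(\mathcal{T}\otimes_A B,N)$ is a right $\mathcal{T}$-module through $(\varphi\leftharpoonup\widetilde t)(\sum t_i\otimes_A b_i)=\varphi(\sum\widetilde t\,t_i\otimes_A b_i)$. Subgeneration: a right $\mathcal{T}$-module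 is $K$-generated if it is a quotient of a direct sum of copies of $K$, and $K$-subgenerated if it is isomorphic to a submodule of a $K$-generated module. $\sigma[K_{\mathcal{T}}]\subseteq\mathbb{M}_{\mathcal{T}}$ is the full subcategory of $K$-subgenerated modules; $\sigma[L_{\mathcal{S}}]$ is defined likewise. The trace functor $\mathrm{Sp}(\sigma[K_{\mathcal{T}}],-):\mathbb{M}_{\mathcal{T}}\to\sigma[K_{\mathcal{T}}]$ is $M\mapsto\sum\{f(N): f\in\mathrm{Hom}_{-\mathcal{T}}(N,M),\ N\in\sigma[K_{\mathcal{T}}]\}$, the largest $\mathcal{T}$-submodule of $M$ belonging to $\sigma[K_{\mathcal{T}}]$. *)

(* Defs.v *)
From HB Require Import structures.
From mathcomp Require Import all_boot all_algebra generic_quotient ring_quotient.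
From mathcomp Require Import boolp classical_sets functions cardinality.
From mathcomp Require Import freeg.

Set Implicit Arguments.
Unset Strict Implicit.
Unset Printing Implicit Defensive.

Set Warnings "-redundant-canonical-projection".

Import GRing.Theory.
Local Open Scope ring_scope.
Local Open Scope quotient_scope.
Local Open Scope classical_set_scope.

(* The library's algType imposes 1 != 0; here the zero algebra is allowed.    *)
HB.mixin Record isUnitalAlgebra (R : comNzRingType) A of GRing.PzRing A := {
  ascale : R -> A -> A;
  ascaleA : forall r s a, ascale r (ascale s a) = ascale (r * s) a;
  ascale1 : forall a, ascale 1 a = a;
  ascaleDr : forall r a b, ascale r (a + b) = ascale r a + ascale r b;
  ascaleDl : forall r s a, ascale (r + s) a = ascale r a + ascale s a;
  ascaleAl : forall r a b, ascale r (a * b) = ascale r a * b;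
  ascaleAr : forall r a b, ascale r (a * b) = a * ascale r b }.

#[short(type="ualgType")]
HB.structure Definition UnitalAlgebra (R : comNzRingType) :=
  {A of GRing.PzRing A & isUnitalAlgebra R A}.

HB.mixin Record isRightModule (A : pzRingType) M of GRing.Zmodule M := {
  ract : M -> A -> M;
  ractDl : forall x y a, ract (x + y) a = ract x a + ract y a;
  ractDr : forall x a b, ract x (a + b) = ract x a + ract x b;
  ractA : forall x a b, ract (ract x a) b = ract x (a * b);
  ract1 : forall x, ract x 1 = x }.

#[short(type="rmodType")]
HB.structure Definition RightModule (A : pzRingType) :=
  {M of GRing.Zmodule M & isRightModule A M}.

HB.mixin Record isBimodule (A B : pzRingType) M
    of GRing.Lmodule A M & RightModule B M := {
  bimodA : forall (a : A) (x : M) (b : B), a *: ract x b = ract (a *: x) b }.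

#[short(type="bimodType")]
HB.structure Definition Bimodule (A B : pzRingType) :=
  {M of GRing.Lmodule A M & RightModule B M & isBimodule A B M}.

Notation "x <* a" := (ract x a) (at level 40, left associativity).

Definition is_additive (U V : zmodType) (f : U -> V) :=
  forall x y, f (x + y) = f x + f y.

Lemma is_additive0 (U V : zmodType) (f : U -> V) : is_additive f -> f 0 = 0.
Proof. by move=> fD; apply: (addrI (f 0)); rewrite -fD !addr0. Qed.

Lemma is_additiveN (U V : zmodType) (f : U -> V) :
  is_additive f -> {morph f : x / - x}.
Proof.
by move=> fD x; apply: (addrI (f x)); rewrite -fD !subrr is_additive0.
Qed.

Record is_bilinear (A B : pzRingType) (U V : bimodType A B) (f : U -> V) :
    Prop := {
  bilinD : is_additive f;
  bilinZl : forall (a : A) x, f (a *: x) = a *: f x;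
  bilinZr : forall x (b : B), f (x <* b) = f x <* b }.

(* Tensor product of a right module and a left module over a noncommutative   *)
(* ring: the free abelian group on M * N modulo the subgroup generated by the *)
(* biadditivity and balancing relations.                                      *)
Section Tensor.
Variables (A : pzRingType) (M : rmodType A) (N : lmodType A).

Definition fpair (m : M) (n : N) : {freeg (M * N) / int} :=
  [freeg [:: (1, (m, n))]].

Record tens_closed (P : {pred {freeg (M * N) / int}}) : Prop := {
  tens_closedB : zmod_closed P;
  tens_closedDl : forall m m' n,
    fpair (m + m') n - (fpair m n + fpair m' n) \in P;
  tens_closedDr : forall m n n',
    fpair m (n + n') - (fpair m n + fpair m n') \in P;
  tens_closedA : forall m a n, fpair (m <* a) n - fpair m (a *: n) \in P }.

Definition tens_rel : {pred {freeg (M * N) / int}} :=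
  fun x => `[< forall P : {pred _}, tens_closed P -> x \in P >].

Lemma tens_relP : tens_closed tens_rel.
Proof.
split.
- split; first by apply/asboolP => P [[]].
  move=> x y /asboolP hx /asboolP hy; apply/asboolP => P hP.
  by case: (hP) => -[_ PB] _ _ _; apply: PB; [apply: hx|apply: hy].
- by move=> m m' n; apply/asboolP => P [].
- by move=> m n n'; apply/asboolP => P [].
- by move=> m a n; apply/asboolP => P [].
Qed.

HB.instance Definition _ :=
  GRing.isZmodClosed.Build _ tens_rel (tens_closedB tens_relP).

Definition tensor : Type := Quotient.quot tens_rel.
HB.instance Definition _ := GRing.Zmodule.on tensor.

Definition tens (m : M) (n : N) : tensor :=
  \pi_(Quotient.quot tens_rel) (fpair m n).

Let tensor_eq x y : (x - y) \in tens_rel ->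
  \pi_(Quotient.quot tens_rel) x = \pi_(Quotient.quot tens_rel) y :> tensor.
Proof. by rewrite Quotient.idealrBE => /eqP. Qed.

Lemma tensDl m m' n : tens (m + m') n = tens m n + tens m' n.
Proof.
have := tensor_eq (tens_closedDl tens_relP m m' n).
by rewrite raddfD.
Qed.

Lemma tensDr m n n' : tens m (n + n') = tens m n + tens m n'.
Proof.
have := tensor_eq (tens_closedDr tens_relP m n n').
by rewrite raddfD.
Qed.

Lemma tensA m a n : tens (m <* a) n = tens m (a *: n).
Proof. exact: tensor_eq (tens_closedA tens_relP m a n). Qed.

Record is_balanced (V : zmodType) (f : M -> N -> V) : Prop := {
  balDl : forall m m' n, f (m + m') n = f m n + f m' n;
  balDr : forall m n n', f m (n + n') = f m n + f m n';
  balA : forall m a n, f (m <* a) n = f m (a *: n) }.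

Section Lift.
Variables (V : zmodType) (f : M -> N -> V).

Definition free_lift (x : {freeg (M * N) / int}) : V :=
  fglift (fun p => f p.1 p.2 : zmodule V) x.

Definition tensor_lift (x : tensor) : V := free_lift (repr x).

Lemma free_lift_pair m n : free_lift (fpair m n) = f m n.
Proof. by rewrite /free_lift liftU scale1r. Qed.

Lemma free_liftB x y : free_lift (x - y) = free_lift x - free_lift y.
Proof. exact: (@lift_is_additive int _ (zmodule V) _ x y). Qed.

Lemma free_liftD : is_additive free_lift.
Proof.
have l0 : free_lift 0 = 0 by have := free_liftB 0 0; rewrite !subrr.
move=> x y; have := free_liftB x (- y).
have := free_liftB 0 y; rewrite opprK sub0r l0 sub0r => -> ->.
by rewrite opprK.
Qed.

Hypothesis fb : is_balanced f.

Lemma free_lift_rel x : x \in tens_rel -> free_lift x = 0.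
Proof.
move=> /asboolP /(_ (fun y => free_lift y == 0)) hx; apply/eqP; apply: hx.
split => [|m m' n|m n n'|m a n]; rewrite ?inE ?unfold_in.
- split=> [|y z]; rewrite !unfold_in; first by rewrite (is_additive0 free_liftD).
  by rewrite free_liftB => /eqP -> /eqP ->; rewrite subrr.
- by rewrite free_liftB free_liftD !free_lift_pair (balDl fb) subrr.
- by rewrite free_liftB free_liftD !free_lift_pair (balDr fb) subrr.
- by rewrite free_liftB !free_lift_pair (balA fb) subrr.
Qed.

Lemma free_lift_pi x :
  tensor_lift (\pi_(Quotient.quot tens_rel) x) = free_lift x.
Proof.
apply/eqP; rewrite -subr_eq0 /tensor_lift -free_liftB free_lift_rel//.
by rewrite Quotient.idealrBE reprK.
Qed.

Lemma tensor_liftE m n : tensor_lift (tens m n) = f m n.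
Proof. by rewrite free_lift_pi free_lift_pair. Qed.

Lemma tensor_lift_additive : is_additive tensor_lift.
Proof.
move=> x y; rewrite -[x]reprK -[y]reprK -raddfD !free_lift_pi.
exact: free_liftD.
Qed.

End Lift.

(* two additive maps on the tensor product agree as soon as they agree on     *)
(* pure tensors                                                               *)
Lemma tensor_ext (V : zmodType) (f g : tensor -> V) :
  is_additive f -> is_additive g ->
  (forall m n, f (tens m n) = g (tens m n)) -> f =1 g.
Proof.
move=> fD gD fg x; rewrite -[x]reprK.
elim/freeg_ind_dom0: (repr x) => [|k [m n] D _ _ IH].
  by rewrite raddf0 !is_additive0.
rewrite raddfD fD gD IH; congr (_ + _).
have -> : [freeg [:: (k, (m, n))]] = fpair m n *~ k.
  by rewrite /fpair freegU_mulz intz.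
have addz (h : tensor -> V) : is_additive h ->
    forall y (z : int), h (y *~ z) = h y *~ z.
  move=> hD y z; have hMn i : h (y *+ i) = h y *+ i.
    elim: i => [|i IHi]; first by rewrite !mulr0n is_additive0.
    by rewrite !mulrS hD IHi.
  case: z => i; first exact: hMn.
  by rewrite !NegzE -!nmulrn is_additiveN ?hMn.
by rewrite raddfMz !addz// fg.
Qed.

End Tensor.


Section TensorBimodule.
Variables (A : pzRingType).

Section Map.
Variables (M M' : rmodType A) (N N' : lmodType A).
Variables (f : M -> M') (g : N -> N').

Definition tensor_map : tensor M N -> tensor M' N' :=
  tensor_lift (fun m n => tens (f m) (g n)).

Hypotheses (fD : is_additive f) (fZ : forall x a, f (x <* a) = f x <* a).
Hypotheses (gD : is_additive g) (gZ : forall a y, g (a *: y) = a *: g y).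

Lemma tensor_map_balanced : is_balanced (fun m n => tens (f m) (g n)).
Proof.
split=> [m m' n|m n n'|m a n]; first by rewrite fD tensDl.
  by rewrite gD tensDr.
by rewrite fZ gZ tensA.
Qed.

Lemma tensor_mapE m n : tensor_map (tens m n) = tens (f m) (g n).
Proof. exact: tensor_liftE tensor_map_balanced _ _. Qed.

Lemma tensor_mapD : is_additive tensor_map.
Proof. exact: tensor_lift_additive tensor_map_balanced. Qed.

End Map.

Section RightAction.
Variables (B : pzRingType) (M : rmodType A) (N : bimodType A B).

Definition tensor_ract (x : tensor M N) (b : B) : tensor M N :=
  tensor_map id (fun n : N => n <* b) x.

Let rD (b : B) : is_additive (fun n : N => n <* b).
Proof. by move=> x y; rewrite ractDl. Qed.

Let rZ (b : B) (a : A) (y : N) : (a *: y) <* b = a *: (y <* b).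
Proof. by rewrite bimodA. Qed.

Lemma tensor_ractE m n b : tensor_ract (tens m n) b = tens m (n <* b).
Proof. exact: tensor_mapE. Qed.

Let ractD b : is_additive (tensor_ract^~ b).
Proof. exact: tensor_mapD. Qed.

Let ract_Dr x b c : tensor_ract x (b + c) = tensor_ract x b + tensor_ract x c.
Proof.
apply: (tensor_ext (f := tensor_ract^~ (b + c))
  (g := fun x => tensor_ract x b + tensor_ract x c)) => //.
  by move=> y z; rewrite !ractD addrACA.
by move=> m n; rewrite !tensor_ractE ractDr tensDr.
Qed.

Let ract_A x b c : tensor_ract (tensor_ract x b) c = tensor_ract x (b * c).
Proof.
apply: (tensor_ext (f := fun x => tensor_ract (tensor_ract x b) c)
  (g := tensor_ract^~ (b * c))) => //.
  by move=> y z; rewrite !ractD.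
by move=> m n; rewrite !tensor_ractE ractA.
Qed.

Let ract_1 x : tensor_ract x 1 = x.
Proof.
apply: (tensor_ext (f := tensor_ract^~ 1) (g := id)) => //.
by move=> m n; rewrite !tensor_ractE ract1.
Qed.

HB.instance Definition _ := isRightModule.Build B (tensor M N)
  (fun x y b => ractD b x y) ract_Dr ract_A ract_1.

Lemma tens_ract m n b : tens m n <* b = tens m (n <* b).
Proof. exact: tensor_ractE. Qed.

End RightAction.

Section LeftAction.
Variables (C : pzRingType) (M : bimodType C A) (N : lmodType A).

Definition tensor_lact (c : C) (x : tensor M N) : tensor M N :=
  tensor_map (fun m : M => c *: m) id x.

Let lD (c : C) : is_additive (fun m : M => c *: m).
Proof. by move=> x y; rewrite scalerDr. Qed.

Let lZ (c : C) (x : M) (a : A) : c *: (x <* a) = (c *: x) <* a.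
Proof. by rewrite bimodA. Qed.

Lemma tensor_lactE c m n : tensor_lact c (tens m n) = tens (c *: m) n.
Proof. exact: tensor_mapE. Qed.

Let lactD c : is_additive (tensor_lact c).
Proof. exact: tensor_mapD. Qed.

Let lact_Dl x : is_additive (tensor_lact^~ x).
Proof.
move=> b c; apply: (tensor_ext (f := tensor_lact (b + c))
  (g := fun x => tensor_lact b x + tensor_lact c x)) => //.
  by move=> y z; rewrite !lactD addrACA.
by move=> m n; rewrite !tensor_lactE scalerDl tensDl.
Qed.

Let lact_A b c x : tensor_lact b (tensor_lact c x) = tensor_lact (b * c) x.
Proof.
apply: (tensor_ext (f := fun x => tensor_lact b (tensor_lact c x))
  (g := tensor_lact (b * c))) => //.
  by move=> y z; rewrite !lactD.
by move=> m n; rewrite !tensor_lactE scalerA.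
Qed.

Let lact_1 x : tensor_lact 1 x = x.
Proof.
apply: (tensor_ext (f := tensor_lact 1) (g := id)) => //.
by move=> m n; rewrite !tensor_lactE scale1r.
Qed.

HB.instance Definition _ := GRing.Zmodule_isLmodule.Build C (tensor M N)
  lact_A lact_1 lactD lact_Dl.

Lemma tens_scale c m n : c *: tens m n = tens (c *: m) n :> tensor M N.
Proof. exact: tensor_lactE. Qed.

End LeftAction.

Section TwoSided.
Variables (B C : pzRingType) (M : bimodType C A) (N : bimodType A B).

Let tensor_bimodA (c : C) (x : tensor M N) (b : B) :
  c *: (x <* b) = (c *: x) <* b.
Proof.
apply: (tensor_ext (f := fun x : tensor M N => c *: (x <* b))
  (g := fun x : tensor M N => (c *: x) <* b)) => [y z|y z|m n].
- by rewrite ractDl scalerDr.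
- by rewrite scalerDr ractDl.
- by rewrite tens_scale !tens_ract tens_scale.
Qed.

HB.instance Definition _ := isBimodule.Build C B (tensor M N) tensor_bimodA.

End TwoSided.

End TensorBimodule.

Section Restriction.
Variables (A B : pzRingType) (beta : {rmorphism A -> B}).

(* B as an (A, B)-bimodule through beta *)
Definition along : Type := let _ := beta in B.

HB.instance Definition _ := GRing.Zmodule.on along.

Let alScale (a : A) (b : along) : along := beta a * b.
Let alAct (b : along) (c : B) : along := (b : B) * c.

HB.instance Definition _ := GRing.Zmodule_isLmodule.Build A along
  (fun a b x => etrans (mulrA _ _ _)
     (congr1 (fun c => c * (x : B)) (esym (rmorphM beta a b))) : alScale _ _ = _)
  (fun x => etrans (congr1 (fun c => c * (x : B)) (rmorph1 beta)) (mul1r _))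
  (fun a x y => mulrDr (beta a) (x : B) y)
  (fun x a b => etrans (congr1 (fun c => c * (x : B)) (rmorphD beta a b))
     (mulrDl _ _ _)).

HB.instance Definition _ := isRightModule.Build B along
  (fun x y b => mulrDl (x : B) y b) (fun x b c => mulrDr (x : B) b c)
  (fun x b c => esym (mulrA (x : B) b c)) (fun x => mulr1 (x : B)).

HB.instance Definition _ := isBimodule.Build A B along
  (fun a x b => mulrA (beta a) (x : B) b).

End Restriction.

Lemma along_scaleE (A B : pzRingType) (beta : {rmorphism A -> B})
  (a : A) (b : along beta) : a *: b = (beta a * b : B).
Proof. by []. Qed.

Lemma along_ractE (A B : pzRingType) (beta : {rmorphism A -> B})
  (b : along beta) (c : B) : b <* c = ((b : B) * c : B).
Proof. by []. Qed.

Section RestrictBimodule.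
Variables (A B : pzRingType) (beta : {rmorphism A -> B}) (V : bimodType B B).

(* a (B, B)-bimodule regarded as an (A, A)-bimodule through beta *)
Definition restr : Type := let _ := beta in V.

HB.instance Definition _ := GRing.Zmodule.on restr.

Let rscale (a : A) (x : restr) : restr := beta a *: (x : V).
Let rright (x : restr) (a : A) : restr := (x : V) <* beta a.

Let rscaleA a b x : rscale a (rscale b x) = rscale (a * b) x.
Proof. by rewrite /rscale scalerA rmorphM. Qed.
Let rscale1 x : rscale 1 x = x.
Proof. by rewrite /rscale rmorph1 scale1r. Qed.
Let rscaleDr a : {morph rscale a : x y / x + y}.
Proof. exact: scalerDr. Qed.
Let rscaleDl x : {morph rscale^~ x : a b / a + b}.
Proof. by move=> a b; rewrite /rscale rmorphD scalerDl. Qed.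

HB.instance Definition _ := GRing.Zmodule_isLmodule.Build A restr
  rscaleA rscale1 rscaleDr rscaleDl.

Let rrightDl x y a : rright (x + y) a = rright x a + rright y a.
Proof. exact: ractDl. Qed.
Let rrightDr x a b : rright x (a + b) = rright x a + rright x b.
Proof. by rewrite /rright rmorphD ractDr. Qed.
Let rrightA x a b : rright (rright x a) b = rright x (a * b).
Proof. by rewrite /rright ractA rmorphM. Qed.
Let rright1 x : rright x 1 = x.
Proof. by rewrite /rright rmorph1 ract1. Qed.

HB.instance Definition _ := isRightModule.Build A restr
  rrightDl rrightDr rrightA rright1.

HB.instance Definition _ := isBimodule.Build A A restr
  (fun a x b => bimodA (beta a) (x : V) (beta b)).

End RestrictBimodule.

Record aring (A : pzRingType) := Aring {
  acar :> bimodType A A;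
  amul : tensor acar acar -> acar;
  aunit : along (idfun : A -> A) -> acar;
  amul_bilin : is_bilinear amul;
  aunit_bilin : is_bilinear aunit;
  amulA : forall x y z,
    amul (tens (amul (tens x y)) z) = amul (tens x (amul (tens y z)));
  amul1l : forall a x, amul (tens (aunit a) x) = a *: x;
  amul1r : forall x a, amul (tens x (aunit a)) = x <* a }.

Record aring_morphism (A : pzRingType) (S T : aring A) := AringMorphism {
  amor :> S -> T;
  amor_bilin : is_bilinear amor;
  amorM : forall x y, amor (amul (tens x y)) = amul (tens (amor x) (amor y));
  amor1 : forall a, amor (aunit S a) = aunit T a }.

Section RestrictRing.
Variables (A B : pzRingType) (beta : {rmorphism A -> B}) (S : aring B).

Let mulS (x y : restr beta S) : restr beta S := amul (tens (x : S) (y : S)).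

Let mulS_balanced : is_balanced mulS.
Proof.
split=> [x y z|x y z|x a y].
- by rewrite /mulS tensDl (bilinD (amul_bilin S)).
- by rewrite /mulS tensDr (bilinD (amul_bilin S)).
- by congr amul; apply: tensA.
Qed.

Definition restr_mul : tensor (restr beta S) (restr beta S) -> restr beta S :=
  tensor_lift mulS.

Definition restr_unit (a : along (idfun : A -> A)) : restr beta S :=
  aunit S (beta a : along idfun).

Lemma restr_mulE (x y : restr beta S) :
  restr_mul (tens x y) = amul (tens (x : S) (y : S)).
Proof. exact: tensor_liftE mulS_balanced _ _. Qed.

Lemma restr_mul_bilin : is_bilinear restr_mul.
Proof.
have mD : is_additive restr_mul by exact: tensor_lift_additive mulS_balanced.
split=> // [a x|x a].
- apply: (tensor_ext (f := fun x => restr_mul (a *: x))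
    (g := fun x => a *: restr_mul x)) => [y z|y z|m n].
  + by rewrite scalerDr mD.
  + by rewrite mD scalerDr.
  + rewrite tens_scale !restr_mulE.
    by have := bilinZl (amul_bilin S) (beta a) (tens (m : S) (n : S)); rewrite tens_scale.
- apply: (tensor_ext (f := fun x => restr_mul (x <* a))
    (g := fun x => restr_mul x <* a)) => [y z|y z|m n].
  + by rewrite ractDl mD.
  + by rewrite mD ractDl.
  + rewrite tens_ract !restr_mulE.
    by have := bilinZr (amul_bilin S) (tens (m : S) (n : S)) (beta a); rewrite tens_ract.
Qed.

Lemma restr_unit_bilin : is_bilinear restr_unit.
Proof.
split=> [a b|a b|a b]; rewrite /restr_unit.
- by rewrite rmorphD; apply: (bilinD (aunit_bilin S)).
- rewrite [a *: b]along_scaleE rmorphM.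
  exact: (bilinZl (aunit_bilin S) (beta a) (beta b : along idfun)).
- rewrite [a <* b]along_ractE rmorphM.
  exact: (bilinZr (aunit_bilin S) (beta a : along idfun) (beta b)).
Qed.

(* the B-ring S regarded as an A-ring through beta *)
Definition restr_aring : aring A.
Proof.
apply: (@Aring A (restr beta S) restr_mul restr_unit
  restr_mul_bilin restr_unit_bilin) => [x y z|a x|x a].
- rewrite !restr_mulE; exact: amulA.
- rewrite restr_mulE; exact: amul1l.
- rewrite restr_mulE; exact: amul1r.
Defined.

End RestrictRing.

(* A right module over the A-ring T is a right module over its underlying     *)
(* ring; it is a right A-module through the unit of T (see und below).        *)
Record is_raction (A : pzRingType) (T : aring A) (M : zmodType)
    (act : M -> T -> M) : Prop := {
  ractionDl : forall x y t, act (x + y) t = act x t + act y t;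
  ractionDr : forall x t u, act x (t + u) = act x t + act x u;
  ractionA : forall x t u, act (act x t) u = act x (amul (tens t u));
  raction1 : forall x, act x (aunit T 1) = x }.

Record tmod (A : pzRingType) (T : aring A) := Tmod {
  tcar :> zmodType;
  tact : tcar -> T -> tcar;
  tactP : is_raction tact }.

Notation "x <-| t" := (tact x t) (at level 40, left associativity).

Lemma tact_additive (A : pzRingType) (T : aring A) (M : tmod T) (t : T) :
  is_additive (fun x : M => x <-| t).
Proof. by move=> x y; apply: ractionDl (tactP M) _ _ _. Qed.

Section Underlying.
Variables (A : pzRingType) (T : aring A).

(* a right T-module regarded as a right A-module through the unit of T *)
Definition und (M : tmod T) : Type := M.

Variable M : tmod T.
HB.instance Definition _ := GRing.Zmodule.on (und M).

Let unit_act (x : und M) (a : A) : und M := (x : M) <-| aunit T a.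

Let unit_actDl x y a : unit_act (x + y) a = unit_act x a + unit_act y a.
Proof. exact: ractionDl (tactP M) _ _ _. Qed.

Let unit_actDr x a b : unit_act x (a + b) = unit_act x a + unit_act x b.
Proof.
rewrite /unit_act -(ractionDr (tactP M)); congr tact.
exact: (bilinD (aunit_bilin T)).
Qed.

Let unit_actA x a b : unit_act (unit_act x a) b = unit_act x (a * b).
Proof.
rewrite /unit_act (ractionA (tactP M)) amul1l; congr tact.
by rewrite -(bilinZl (aunit_bilin T)).
Qed.

Let unit_act1 x : unit_act x 1 = x.
Proof. exact: raction1 (tactP M) _. Qed.

HB.instance Definition _ := isRightModule.Build A (und M)
  unit_actDl unit_actDr unit_actA unit_act1.

Lemma und_ractE (x : und M) (a : A) : x <* a = ((x : M) <-| aunit T a : M).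
Proof. by []. Qed.

End Underlying.

Record is_tlin (A : pzRingType) (T : aring A) (M N : tmod T) (f : M -> N) :
    Prop := {
  is_tlinD : is_additive f;
  is_tlinZ : forall x t, f (x <-| t) = f x <-| t }.

Section Hom.
Variables (A : pzRingType) (T : aring A) (M N : tmod T).

Definition tlin_pred : {pred M -> N} := fun f => `[< is_tlin f >].

Let tlin_closed : zmod_closed tlin_pred.
Proof.
have actN (x : N) t : (- x) <-| t = - (x <-| t).
  exact: is_additiveN (@tact_additive _ _ N t) x.
have act0 t : (0 : N) <-| t = 0 by exact: is_additive0 (@tact_additive _ _ N t).
split=> [|f g /asboolP hf /asboolP hg]; apply/asboolP; split=> [x y|x t].
- by rewrite /= addr0.
- by rewrite act0.
- rewrite -[LHS]/(f (x + y) - g (x + y)) (is_tlinD hf) (is_tlinD hg).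
  by rewrite opprD addrACA.
- rewrite -[LHS]/(f (x <-| t) - g (x <-| t)) (is_tlinZ hf) (is_tlinZ hg).
  by rewrite -actN -(ractionDl (tactP N)).
Qed.

HB.instance Definition _ := GRing.isZmodClosed.Build _ tlin_pred tlin_closed.

Record tlin := Tlin { tfun :> M -> N; _ : tfun \in tlin_pred }.

HB.instance Definition _ := [isSub for tfun].
HB.instance Definition _ := [Choice of tlin by <:].
HB.instance Definition _ := [SubChoice_isSubZmodule of tlin by <:].

Lemma tlinP (f : tlin) : is_tlin f.
Proof. by case: f => f /= /asboolP. Qed.

Lemma tlin_additive (f : tlin) : is_additive f.
Proof. exact: is_tlinD (tlinP f). Qed.

Lemma tlin_act (f : tlin) x t : f (x <-| t) = f x <-| t.
Proof. exact: is_tlinZ (tlinP f) _ _. Qed.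

Lemma tlin_ext (f g : tlin) : f =1 g -> f = g.
Proof. by move=> fg; apply: val_inj; apply/funext. Qed.

Definition mk_tlin (f : M -> N) (hf : is_tlin f) : tlin := Tlin (asboolT hf).

End Hom.

Section Composition.
Variables (A : pzRingType) (T : aring A).

Lemma is_tlin_id (M : tmod T) : is_tlin (@id M).
Proof. by []. Qed.

Definition tlin_id (M : tmod T) : tlin M M := mk_tlin (is_tlin_id M).

Lemma is_tlin_comp (M N P : tmod T) (g : tlin N P) (f : tlin M N) :
  is_tlin (g \o f).
Proof.
split=> [x y|x t] /=; first by rewrite !tlin_additive.
by rewrite !tlin_act.
Qed.

Definition tlin_comp (M N P : tmod T) (g : tlin N P) (f : tlin M N) :
  tlin M P := mk_tlin (is_tlin_comp g f).

End Composition.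

Record category := Category {
  obj :> Type;
  hom : obj -> obj -> Type;
  idc : forall X, hom X X;
  comp : forall X Y Z, hom Y Z -> hom X Y -> hom X Z;
  compA : forall X Y Z W (h : hom Z W) (g : hom Y Z) (f : hom X Y),
    comp h (comp g f) = comp (comp h g) f;
  comp1l : forall X Y (f : hom X Y), comp (idc Y) f = f;
  comp1r : forall X Y (f : hom X Y), comp f (idc X) = f }.

Record functor (C D : category) := Functor {
  fobj :> C -> D;
  fmap : forall X Y : C, hom X Y -> hom (fobj X) (fobj Y);
  fmap1 : forall X : C, fmap (idc X) = idc (fobj X);
  fmapM : forall (X Y Z : C) (g : hom Y Z) (f : hom X Y),
    fmap (comp g f) = comp (fmap g) (fmap f) }.

Definition comp_functor (C D E : category) (G : functor D E) (F : functor C D) :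
  functor C E.
Proof.
exists (fun X => G (F X)) (fun X Y f => fmap G (fmap F f)).
- by move=> X; rewrite !fmap1.
- by move=> X Y Z g f; rewrite !fmapM.
Defined.

Definition full_subcat (C : category) (P : C -> Prop) : category.
Proof.
exists {X : C | P X} (fun X Y => hom (sval X) (sval Y))
  (fun X => idc (sval X)) (fun X Y Z g f => comp g f).
- by move=> *; rewrite compA.
- by move=> *; rewrite comp1l.
- by move=> *; rewrite comp1r.
Defined.

Definition restrict_functor (C D : category) (F : functor C D)
  (P : C -> Prop) (Q : D -> Prop) (FPQ : forall X, P X -> Q (F X)) :
  functor (full_subcat P) (full_subcat Q).
Proof.
exists (fun X : full_subcat P =>
          exist Q (F (sval X)) (FPQ _ (svalP X)) : full_subcat Q)
  (fun X Y f => fmap F f).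
- by move=> X; apply: fmap1.
- by move=> X Y Z g f; apply: fmapM.
Defined.

(* F is left adjoint to G *)
Definition adjoint_pair (C D : category) (F : functor C D) (G : functor D C) :=
  exists Phi : forall (X : C) (Y : D), hom (F X) Y -> hom X (G Y),
  [/\ forall X Y, bijective (Phi X Y),
      forall X X' Y (h : hom (F X) Y) (f : hom X' X),
        Phi X' Y (comp h (fmap F f)) = comp (Phi X Y h) f
    & forall X Y Y' (g : hom Y Y') (h : hom (F X) Y),
        Phi X Y' (comp g h) = comp (fmap G g) (Phi X Y h)].

Definition ModCat (A : pzRingType) (T : aring A) : category.
Proof.
by exists (tmod T) (@tlin A T) (@tlin_id A T) (@tlin_comp A T) => *;
  apply: tlin_ext.
Defined.

Section Subgeneration.
Variables (A : pzRingType) (T : aring A) (K : tmod T).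

Section DirectSum.
Variable I : Type.

Definition finsupp_pred : {pred I -> K} :=
  fun f => `[< finite_set [set i | f i != 0] >].

Let finsupp_closed : zmod_closed finsupp_pred.
Proof.
split; first apply/asboolP.
  by rewrite (_ : [set i | _] = set0) // -subset0 => i /=; rewrite eqxx.
move=> f g /asboolP hf /asboolP hg; apply/asboolP.
have /sub_finite_set : [set i | (f - g) i != 0] `<=`
    [set i | f i != 0] `|` [set i | g i != 0].
  move=> i /= fg; have [f0|] := eqVneq (f i) 0; last by left.
  right; apply: contra_neq fg => g0.
  by rewrite -[LHS]/(f i - g i) f0 g0 subrr.
by apply; rewrite finite_setU.
Qed.

HB.instance Definition _ :=
  GRing.isZmodClosed.Build _ finsupp_pred finsupp_closed.

Record dsum_car := Dsum { dsum_fun :> I -> K; _ : dsum_fun \in finsupp_pred }.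

HB.instance Definition _ := [isSub for dsum_fun].
HB.instance Definition _ := [Choice of dsum_car by <:].
HB.instance Definition _ := [SubChoice_isSubZmodule of dsum_car by <:].

Let dsum_act_supp (f : dsum_car) (t : T) :
  (fun i => f i <-| t) \in finsupp_pred.
Proof.
case: f => f /= /asboolP hf; apply/asboolP; apply: sub_finite_set hf => i /=.
apply: contra_neq => ->; exact: is_additive0 (@tact_additive _ _ K t).
Qed.

Definition dsum_act (f : dsum_car) (t : T) : dsum_car :=
  Dsum (dsum_act_supp f t).

Lemma dsum_actP : is_raction dsum_act.
Proof.
split=> [x y t|x t u|x t u|x]; apply: val_inj; apply/funext => i /=.
- exact: ractionDl (tactP K) _ _ _.
- exact: ractionDr (tactP K) _ _ _.
- exact: ractionA (tactP K) _ _ _.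
- exact: raction1 (tactP K) _.
Qed.

(* the direct sum of copies of K indexed by I *)
Definition dsum : tmod T := Tmod dsum_actP.

End DirectSum.

Definition generated (M : tmod T) :=
  exists (I : Type) (p : tlin (dsum I) M), forall y, exists x, p x = y.

Definition subgenerated (M : tmod T) :=
  exists (N : tmod T) (i : tlin M N), generated N /\ injective i.

End Subgeneration.

Section Trace.
Variables (A : pzRingType) (T : aring A) (K : tmod T).

(* the sum of the images f(N), for f : N -> M linear and N in sigma[K] *)
Definition Sp_pred (M : tmod T) : {pred M} := fun x =>
  `[< exists s : seq M,
        (forall y, y \in s -> exists (N : tmod T) (f : tlin N M) (n : N),
            subgenerated K N /\ y = f n) /\
        x = \sum_(y <- s) y >].
Arguments Sp_pred : clear implicits.

Section Object.
Variable M : tmod T.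

Let Sp_closed : zmod_closed (Sp_pred M).
Proof.
split; first by apply/asboolP; exists [::]; rewrite big_nil.
move=> x y /asboolP[s [hs ->]] /asboolP[s' [hs' ->]]; apply/asboolP.
exists (s ++ map -%R s'); split; last by rewrite big_cat big_map sumrN.
move=> z; rewrite mem_cat => /orP[/hs //|/mapP[{}y /hs'[N [f [n [hN ->]]]] ->]].
by exists N, f, (- n); rewrite (is_additiveN (tlin_additive f)).
Qed.

HB.instance Definition _ := GRing.isZmodClosed.Build _ (Sp_pred M) Sp_closed.

Record Sp_car := SpElt { Sp_val :> M; _ : Sp_val \in Sp_pred M }.

HB.instance Definition _ := [isSub for Sp_val].
HB.instance Definition _ := [Choice of Sp_car by <:].
HB.instance Definition _ := [SubChoice_isSubZmodule of Sp_car by <:].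

End Object.

Lemma Sp_pred_fun (M N : tmod T) (g : tlin M N) x :
  x \in Sp_pred M -> g x \in Sp_pred N.
Proof.
move=> /asboolP[s [hs ->]]; apply/asboolP; exists (map g s); split.
  move=> z /mapP[y /hs[P [f [n [hP ->]]]] ->].
  by exists P, (tlin_comp g f), n.
rewrite big_map; elim: (s) => [|y r IHr].
  by rewrite !big_nil (is_additive0 (tlin_additive g)).
by rewrite !big_cons tlin_additive IHr.
Qed.

Let Sp_act_closed (M : tmod T) (x : Sp_car M) (t : T) :
  (x : M) <-| t \in Sp_pred M.
Proof.
case: x => x /= /asboolP[s [hs ->]]; apply/asboolP.
exists (map (fun y : M => y <-| t) s); split.
  move=> z /mapP[y /hs[N [f [n [hN ->]]]] ->].
  by exists N, f, (n <-| t); rewrite tlin_act.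
have tD := @tact_additive _ _ M t.
rewrite big_map; elim: (s) => [|y r IHr].
  by rewrite !big_nil (is_additive0 tD).
by rewrite !big_cons -IHr -tD.
Qed.

Definition Sp_act (M : tmod T) (x : Sp_car M) (t : T) : Sp_car M :=
  SpElt (Sp_act_closed x t).

Lemma Sp_actP (M : tmod T) : is_raction (@Sp_act M).
Proof.
split=> [x y t|x t u|x t u|x]; apply: val_inj => /=.
- exact: ractionDl (tactP M) _ _ _.
- exact: ractionDr (tactP M) _ _ _.
- exact: ractionA (tactP M) _ _ _.
- exact: raction1 (tactP M) _.
Qed.

Definition Sp (M : tmod T) : tmod T := Tmod (Sp_actP M).

Definition Sp_fun (M N : tmod T) (g : tlin M N) (x : Sp M) : Sp N :=
  SpElt (Sp_pred_fun g (valP (x : Sp_car M))).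

Lemma Sp_fun_tlin (M N : tmod T) (g : tlin M N) : is_tlin (Sp_fun g).
Proof.
split=> [x y|x t]; apply: val_inj => /=; first exact: tlin_additive.
exact: tlin_act.
Qed.

(* the trace functor, landing in sigma[K] but typed as an endofunctor *)
Definition Sp_functor : functor (ModCat T) (ModCat T).
Proof.
exists (Sp : ModCat T -> ModCat T) (fun M N g => mk_tlin (Sp_fun_tlin g)).
- by move=> M; apply: tlin_ext => x; apply: val_inj.
- by move=> M N P g f; apply: tlin_ext => x; apply: val_inj.
Defined.

End Trace.

Section Induction.
Variables (A B : pzRingType) (beta : {rmorphism A -> B}).
Variables (T : aring A) (S : aring B).
Variable xi : aring_morphism (restr_aring beta S) T.

Definition tensB (M : tmod T) : Type := tensor (und M) (along beta).
HB.instance Definition _ M := GRing.Zmodule.on (tensB M).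

Definition tens_elt (M : tmod T) (m : M) (b : B) : tensB M :=
  tens (m : und M) (b : along beta).

(* The rule (m (x) b) s = (m xi(s)) (x) b is not automatically well defined: *)
(* that it turns M (x)_A B into a right S-module for every M is part of the   *)
(* setting.                                                                   *)
Record induced_action := InducedAction {
  ind_act : forall M : tmod T, tensB M -> S -> tensB M;
  ind_actP : forall M, is_raction (ind_act (M := M));
  ind_actE : forall (M : tmod T) (m : M) (b : B) (s : S),
    ind_act (tens_elt m b) s = tens_elt (m <-| xi s) b }.

Variable ind : induced_action.

Definition induced (M : tmod T) : tmod S := Tmod (ind_actP ind M).

Definition induced_fun (M N : tmod T) (f : tlin M N) :
  induced M -> induced N :=
  tensor_map (f : und M -> und N) (id : along beta -> along beta).

Let und_fun (M N : tmod T) (f : tlin M N) (x : und M) a :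
  (f : und M -> und N) (x <* a) = (f : und M -> und N) x <* a.
Proof. exact: tlin_act. Qed.

Lemma induced_funE (M N : tmod T) (f : tlin M N) (m : M) (b : B) :
  induced_fun f (tens_elt m b) = tens_elt (f m) b.
Proof.
by apply: tensor_mapE => //; [exact: tlin_additive|exact: und_fun].
Qed.

Lemma induced_funP (M N : tmod T) (f : tlin M N) : is_tlin (induced_fun f).
Proof.
have fD : is_additive (induced_fun f).
  by apply: tensor_mapD => //; [exact: tlin_additive|exact: und_fun].
split=> // x s.
apply: (tensor_ext (V := induced N)
  (f := fun x : tensB M => induced_fun f ((x : induced M) <-| s))
  (g := fun x : tensB M => induced_fun f x <-| s)) => [y z|y z|m b].
- by rewrite -fD; congr induced_fun; apply: (ractionDl (tactP (induced M))).
- by rewrite -(ractionDl (tactP (induced N))); congr tact; apply: fD.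
- rewrite -/(tens_elt (m : M) b) [X in induced_fun f X](ind_actE ind).
  by rewrite !induced_funE [RHS](ind_actE ind) tlin_act.
Qed.

Definition induced_functor : functor (ModCat T) (ModCat S).
Proof.
exists (induced : ModCat T -> ModCat S) (fun M N f => mk_tlin (induced_funP f)).
- move=> M; apply: tlin_ext => /=; apply: tensor_ext => // [|m b].
    exact: is_tlinD (induced_funP (tlin_id M)).
  exact: (induced_funE (tlin_id M) (m : M) b).
- move=> M N P g f; apply: tlin_ext => /=; apply: tensor_ext => // [||m b].
  + exact: is_tlinD (induced_funP (tlin_comp g f)).
  + by move=> x y; rewrite /= !(is_tlinD (induced_funP _)).
  + rewrite -/(tens_elt (m : M) b) /=.
    by rewrite (induced_funE (tlin_comp g f)) !induced_funE.
Defined.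

(* T as a right module over itself *)
Lemma regularP : is_raction (fun x t : T => amul (tens x t)).
Proof.
split=> [x y t|x t u|x t u|x].
- by rewrite tensDl (bilinD (amul_bilin T)).
- by rewrite tensDr (bilinD (amul_bilin T)).
- exact: amulA.
- by rewrite amul1r ract1.
Qed.

Definition regular : tmod T := Tmod regularP.

Lemma lmulP (t : T) :
  is_tlin ((fun x => amul (tens t x)) : regular -> regular).
Proof.
split=> [x y|x u]; first by rewrite tensDr (bilinD (amul_bilin T)).
by rewrite /= amulA.
Qed.

Definition lmul (t : T) : tlin regular regular := mk_tlin (lmulP t).

Section HomModule.
Variable N : tmod S.

(* (phi t)(x (x) b) = phi (t x (x) b), see hom_actE *)
Definition hom_act (phi : tlin (induced regular) N) (t : T) :
  tlin (induced regular) N :=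
  tlin_comp phi (mk_tlin (induced_funP (lmul t))).

Lemma hom_actE (phi : tlin (induced regular) N) (t x : T) (b : B) :
  hom_act phi t (tens_elt (x : regular) b) =
  phi (tens_elt (amul (tens t x) : regular) b).
Proof. by rewrite /= induced_funE. Qed.

Let hom_ext (phi psi : tlin (induced regular) N) :
  (forall (x : T) (b : B),
    phi (tens_elt (x : regular) b) = psi (tens_elt (x : regular) b)) ->
  phi = psi.
Proof.
move=> h; apply: tlin_ext; apply: (tensor_ext (tlin_additive phi) (tlin_additive psi)).
exact: h.
Qed.

Lemma hom_actP : is_raction hom_act.
Proof.
split=> [f g t|f t u|f t u|f]; apply: hom_ext => x b.
- by [].
- rewrite -[RHS]/(hom_act f t (tens_elt (x : regular) b) +
    hom_act f u (tens_elt (x : regular) b)) !hom_actE.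
  rewrite -[RHS](tlin_additive f); congr (f _).
  by rewrite tensDl (bilinD (amul_bilin T)) /tens_elt tensDl.
- by rewrite !hom_actE amulA.
- by rewrite hom_actE amul1l scale1r.
Qed.

Definition hom_mod : tmod T := Tmod hom_actP.

End HomModule.

Definition hom_fun (N P : tmod S) (g : tlin N P) (phi : hom_mod N) :
  hom_mod P := tlin_comp g phi.

Lemma hom_funP (N P : tmod S) (g : tlin N P) : is_tlin (hom_fun g).
Proof.
split=> [f h|f t]; apply: tlin_ext => x //=; exact: tlin_additive.
Qed.

Definition hom_functor : functor (ModCat S) (ModCat T).
Proof.
exists (hom_mod : ModCat S -> ModCat T) (fun N P g => mk_tlin (hom_funP g)).
- by move=> N; apply: tlin_ext => f; apply: tlin_ext.
- by move=> N P Q g f; apply: tlin_ext => h; apply: tlin_ext.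
Defined.

(* N |-> Sp(sigma[K], Hom_S(T (x)_A B, N)) *)
Definition Coind (K : tmod T) : functor (ModCat S) (ModCat T) :=
  comp_functor (Sp_functor K) hom_functor.

End Induction.

(* Main.v *)
(** Call x in M dominated by K if, for some finite s in K, every t in T that
    kills s kills x.  A module M is K-subgenerated iff all its elements are
    dominated: if s_x witnesses the domination of x, then inside the quotient
    of K^(M * nat) by the vectors \sum_x s_x t_x with \sum_x x t_x = 0, the
    classes of the vectors s_x form a copy of M.

    Since dominated elements form a submodule, the trace lies in sigma[K].  For
    the induction functor, M (x)_A B is spanned by the images of the S-linear
    maps m |-> m (x) b, which reduces the claim to the S-module K; that embeds
    in K (x)_A B through k |-> k (x) 1, because B acts on K through S.

    The adjunction is h |-> (m |-> (t (x) b |-> h (m t (x) b))), with inverse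
    g |-> (m (x) b |-> g m (1 (x) b)); its values lie in the trace because
    they are images of elements of a K-subgenerated module. *)

Require Import Defs.
From HB Require Import structures.
From mathcomp Require Import all_boot all_algebra.
From mathcomp Require Import boolp classical_sets functions cardinality.
From mathcomp Require Import generic_quotient ring_quotient.

Set Implicit Arguments.
Unset Strict Implicit.
Unset Printing Implicit Defensive.

Import GRing.Theory.
Local Open Scope ring_scope.
Local Open Scope quotient_scope.

(** The projection modulo the subgroup [P] is additive and vanishes on pure tensors, so [tensor_ext]
    identifies it with zero. *)
Lemma tensor_ind (A : pzRingType) (M : rmodType A) (N : lmodType A)
    (P : {pred tensor M N}) :
  zmod_closed P -> (forall m n, tens m n \in P) -> forall z, z \in P.
Proof.
move=> P_closed Pmn z.
pose U : zmodClosed (tensor M N) :=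
  HB.pack P (GRing.isZmodClosed.Build _ P P_closed).
change (z \in U); rewrite -[z]subr0 Quotient.idealrBE; apply/eqP.
rewrite raddf0.
apply: (tensor_ext (V := Quotient.quot U) (f := \pi_(Quotient.quot U))
  (g := fun=> 0)) => [x y|x y|m n]; first exact: raddfD.
  by rewrite addr0.
rewrite -[RHS](raddf0 (\pi_(Quotient.quot U))).
by apply/eqP; rewrite -Quotient.idealrBE subr0 Pmn.
Qed.

Lemma additive_sum (U V : zmodType) (f : U -> V) (I : Type) (r : seq I)
    (P : pred I) (F : I -> U) :
  is_additive f -> f (\sum_(i <- r | P i) F i) = \sum_(i <- r | P i) f (F i).
Proof. by move=> fD; apply: (big_morph f fD (is_additive0 fD)). Qed.

(** * Elementary rules for module actions *)

Section Actions.
Variables (A : pzRingType) (T : aring A).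
Implicit Type M : tmod T.

Lemma tact0l M (t : T) : (0 : M) <-| t = 0.
Proof. exact: is_additive0 (@tact_additive _ _ M t). Qed.

Lemma tactNl M (x : M) (t : T) : (- x) <-| t = - (x <-| t).
Proof. exact: is_additiveN (@tact_additive _ _ M t) x. Qed.

Lemma tactDl M (x y : M) (t : T) : (x + y) <-| t = x <-| t + y <-| t.
Proof. exact: tact_additive. Qed.

Lemma tact_additiver M (x : M) : is_additive (fun t : T => x <-| t).
Proof. exact: ractionDr (tactP M) x. Qed.

Lemma tactNr M (x : M) (t : T) : x <-| (- t) = - (x <-| t).
Proof. exact: is_additiveN (tact_additiver x) t. Qed.

Lemma tactA M (x : M) (t u : T) : x <-| t <-| u = x <-| amul (tens t u).
Proof. exact: ractionA (tactP M) x t u. Qed.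

Lemma tact1 M (x : M) : x <-| aunit T 1 = x.
Proof. exact: raction1 (tactP M) x. Qed.

End Actions.

(** * Quotients by submodules *)

Section QuotientModule.
Variables (A : pzRingType) (T : aring A) (M : tmod T) (U : zmodClosed M).
Hypothesis Uact : forall (x : M) (t : T), x \in U -> x <-| t \in U.

Definition quot_act (q : Quotient.quot U) (t : T) : Quotient.quot U :=
  \pi_(Quotient.quot U) (repr q <-| t).

Lemma quot_eq (x y : M) : x - y \in U ->
  \pi_(Quotient.quot U) x = \pi_(Quotient.quot U) y.
Proof. by rewrite Quotient.idealrBE => /eqP. Qed.

Lemma quot_actE (x : M) (t : T) :
  quot_act (\pi_(Quotient.quot U) x) t = \pi_(Quotient.quot U) (x <-| t).
Proof.
apply: quot_eq; rewrite -tactNl -tactDl; apply: Uact.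
by rewrite Quotient.idealrBE reprK.
Qed.

Lemma quot_actP : is_raction quot_act.
Proof.
have piD (x y : M) : \pi_(Quotient.quot U) (x + y)
    = \pi_(Quotient.quot U) x + \pi_(Quotient.quot U) y by exact: raddfD.
split.
- move=> x y t; rewrite -[x]reprK -[y]reprK -[in LHS]piD.
  by rewrite !quot_actE tactDl piD.
- by move=> x t u; rewrite -[x]reprK !quot_actE tact_additiver piD.
- move=> x t u; rewrite -[x]reprK 2!(quot_actE (repr x)) quot_actE.
  by rewrite tactA.
- by move=> x; rewrite -[x]reprK quot_actE tact1.
Qed.

Definition quot_mod : tmod T := Tmod quot_actP.

Lemma quot_pi_tlin : is_tlin (\pi_(Quotient.quot U) : M -> quot_mod).
Proof. by split=> [x y|x t]; [exact: raddfD | rewrite -quot_actE]. Qed.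

End QuotientModule.

(** * Elements dominated by [K] *)

Section Dominated.
Variables (A : pzRingType) (T : aring A) (K M : tmod T).

(* Equivalently, the cyclic module x T is a subquotient of a finite power     *)
(* of K.                                                                      *)
Definition dominated : {pred M} := fun x => `[< exists s : seq K,
  forall t : T, (forall k, k \in s -> k <-| t = 0) -> x <-| t = 0 >].

Lemma dominated_closed : zmod_closed dominated.
Proof.
split; first by apply/asboolP; exists [::] => t _; rewrite tact0l.
move=> x y /asboolP[s hs] /asboolP[s' hs']; apply/asboolP.
exists (s ++ s') => t ht; rewrite tactDl tactNl hs ?hs' ?subrr // => k ks;
  by apply: ht; rewrite mem_cat ks ?orbT.
Qed.

HB.instance Definition _ :=
  GRing.isZmodClosed.Build _ dominated dominated_closed.

End Dominated.
Arguments dominated {A T} K M.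

Lemma dominated_tlin (A : pzRingType) (T : aring A) (K M N : tmod T)
    (f : tlin M N) (x : M) :
  x \in dominated K M -> f x \in dominated K N.
Proof.
move=> /asboolP[s hs]; apply/asboolP; exists s => t /hs xt.
by rewrite -tlin_act xt (is_additive0 (tlin_additive f)).
Qed.

Lemma dominated_inj (A : pzRingType) (T : aring A) (K M N : tmod T)
    (f : tlin M N) (x : M) :
  injective f -> f x \in dominated K N -> x \in dominated K M.
Proof.
move=> f_inj /asboolP[s hs]; apply/asboolP; exists s => t /hs xt.
by apply: f_inj; rewrite tlin_act xt (is_additive0 (tlin_additive f)).
Qed.

(** The finitely many values of [f] on its support serve as witness. *)
Lemma dominated_dsum (A : pzRingType) (T : aring A) (K : tmod T) (I : Type)
    (f : dsum K I) :
  f \in dominated K (dsum K I).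
Proof.
case: f => f fS; have /asboolP/finite_image := fS.
move=> /(_ _ f) /finite_seqP[s hs]; apply/asboolP.
exists s => t ht; apply: val_inj; apply/funext => i /=.
have [->|fi] := eqVneq (f i) 0; first exact: tact0l.
apply: ht; have : [set` s]%classic (f i) by rewrite -hs; exists i.
by [].
Qed.

(** * Embedding a module of dominated elements into a [K]-generated one *)

Section Embedding.
Variables (A : pzRingType) (T : aring A) (K M : tmod T).
Variable k : M -> seq K.
Hypothesis kP : forall (x : M) (t : T),
  (forall y, y \in k x -> y <-| t = 0) -> x <-| t = 0.

Lemma dom_vec_supp (x : M) :
  (fun p : M * nat => if p.1 == x then (k x)`_p.2 else 0)
    \in @finsupp_pred _ _ K (M * nat)%type.
Proof.
apply/asboolP; apply: (@sub_finite_set _ _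
  ((fun i => (x, i)) @` `I_(size (k x)))%classic); last first.
  exact/finite_image/finite_II.
move=> [y i] /=; case: (y =P x) => [->|_]; last by rewrite eqxx.
(* Past the end of [k x] the default value is [0], which bounds the second index. *)
move=> ki; exists i => //=; rewrite ltnNge; apply: contra_neqN ki.
exact: nth_default.
Qed.

(* The finite sequence k x, placed in the copies of K indexed by (x, _).      *)
Definition dom_vec (x : M) : dsum K (M * nat) := Dsum (dom_vec_supp x).

(** Lists of pairs encode formal combinations of elements of [M] over [T]; [vcomb] and [mcomb]
    evaluate the same list in the direct sum and in [M]. *)
Definition vcomb (s : seq (M * T)) : dsum K (M * nat) :=
  \sum_(p <- s) dom_vec p.1 <-| p.2.

Definition mcomb (s : seq (M * T)) : M := \sum_(p <- s) p.1 <-| p.2.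

Lemma vcombE s (y : M) (i : nat) :
  dsum_fun (vcomb s) (y, i) = (k y)`_i <-| \sum_(p <- s | p.1 == y) p.2.
Proof.
rewrite (additive_sum _ _ _ (tact_additiver _)).
have -> : dsum_fun (vcomb s) (y, i)
    = \sum_(p <- s) dsum_fun (dom_vec p.1 <-| p.2) (y, i).
  exact: (additive_sum (f := fun g : dsum K (M * nat) => dsum_fun g (y, i))).
rewrite [RHS]big_mkcond; apply: eq_bigr => -[x t] _ /=; rewrite eq_sym.
by case: eqP => [->|_] //; rewrite tact0l.
Qed.

(** The coordinates with first index [y] say that the total coefficient of [y] kills [k y], hence
    [y] by [kP]. Grouping [mcomb s] by first components then gives zero. *)
Lemma vcomb_eq0 s : vcomb s = 0 -> mcomb s = 0.
Proof.
move=> s0; have y0 (y : M) : y <-| \sum_(p <- s | p.1 == y) p.2 = 0.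
  apply: kP => _ /(nthP 0)[i _ <-].
  by rewrite -vcombE s0.
(* Each term becomes a sum over the distinct first components, exactly one of which matches. *)
rewrite /mcomb; transitivity
  (\sum_(p <- s) \sum_(y <- undup (map fst s) | p.1 == y) y <-| p.2).
  rewrite big_seq [RHS]big_seq; apply: eq_bigr => p ps.
  rewrite (eq_bigl (pred1 p.1)) => [|y]; last exact: eq_sym.
  rewrite -big_filter filter_pred1_uniq ?undup_uniq ?mem_undup ?map_f //.
  by rewrite big_seq1.
rewrite (exchange_big_dep xpredT) //= big1 // => y _.
by rewrite -(additive_sum _ _ _ (tact_additiver _)).
Qed.

Lemma vcomb_cat s1 s2 : vcomb (s1 ++ s2) = vcomb s1 + vcomb s2.
Proof. exact: big_cat. Qed.

Lemma mcomb_cat s1 s2 : mcomb (s1 ++ s2) = mcomb s1 + mcomb s2.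
Proof. exact: big_cat. Qed.

Lemma vcomb1 x t : vcomb [:: (x, t)] = dom_vec x <-| t.
Proof. exact: big_seq1. Qed.

Lemma mcomb1 x t : mcomb [:: (x, t)] = x <-| t.
Proof. exact: big_seq1. Qed.

Definition opp_comb (s : seq (M * T)) := [seq (p.1, - p.2) | p <- s].

Lemma vcomb_opp s : vcomb (opp_comb s) = - vcomb s.
Proof.
by rewrite /vcomb big_map -sumrN; apply: eq_bigr => p _; rewrite tactNr.
Qed.

Lemma mcomb_opp s : mcomb (opp_comb s) = - mcomb s.
Proof.
by rewrite /mcomb big_map -sumrN; apply: eq_bigr => p _; rewrite tactNr.
Qed.

Definition relations : {pred dsum K (M * nat)} :=
  fun v => `[< exists2 s, v = vcomb s & mcomb s = 0 >].

Lemma relations_closed : zmod_closed relations.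
Proof.
split; first by apply/asboolP; exists [::]; rewrite /vcomb /mcomb ?big_nil.
move=> _ _ /asboolP[s -> s0] /asboolP[s' -> s0']; apply/asboolP.
exists (s ++ opp_comb s'); first by rewrite vcomb_cat vcomb_opp.
by rewrite mcomb_cat mcomb_opp s0 s0' subrr.
Qed.

HB.instance Definition _ :=
  GRing.isZmodClosed.Build _ relations relations_closed.

Lemma relations_act v (t : T) : v \in relations -> v <-| t \in relations.
Proof.
move=> /asboolP[s -> s0]; apply/asboolP.
exists [seq (p.1, amul (tens p.2 t)) | p <- s].
  rewrite /vcomb big_map (additive_sum _ _ _ (@tact_additive _ _ _ t)).
  by apply: eq_bigr => p _; rewrite tactA.
transitivity (mcomb s <-| t); last by rewrite s0 tact0l.
rewrite /mcomb big_map (additive_sum _ _ _ (@tact_additive _ _ _ t)).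
by apply: eq_bigr => p _; rewrite tactA.
Qed.

Definition dom_quot : tmod T := quot_mod relations_act.

Definition dom_embed (x : M) : dom_quot :=
  \pi_(Quotient.quot relations) (dom_vec x).

Lemma dom_embed_tlin : is_tlin dom_embed.
Proof.
split=> [x y|x t].
- rewrite /dom_embed -raddfD; apply: quot_eq; apply/asboolP.
  (* The witness is the formal combination [(x + y) 1 - x 1 - y 1], whose value in [M] is zero. *)
  exists ([:: (x + y, aunit T 1)] ++ opp_comb
      ([:: (x, aunit T 1)] ++ [:: (y, aunit T 1)])).
    by rewrite !(vcomb_cat, vcomb_opp, vcomb1) !tact1.
  by rewrite !(mcomb_cat, mcomb_opp, mcomb1) !tact1 subrr.
- rewrite [RHS](quot_actE relations_act); apply: quot_eq; apply/asboolP.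
  exists ([:: (x <-| t, aunit T 1)] ++ opp_comb [:: (x, t)]).
    by rewrite vcomb_cat vcomb_opp !vcomb1 tact1.
  by rewrite mcomb_cat mcomb_opp !mcomb1 tact1 subrr.
Qed.

(** If [dom_vec x - dom_vec y] is [vcomb s] with [mcomb s = 0], the formal combination [x - y - s]
    vanishes in the direct sum, hence in [M], where its value is [x - y]. *)
Lemma dom_embed_inj : injective dom_embed.
Proof.
move=> x y /eqP; rewrite /dom_embed -Quotient.idealrBE => /asboolP[s sE s0].
have := @vcomb_eq0 ([:: (x, aunit T 1)] ++ opp_comb [:: (y, aunit T 1)]
  ++ opp_comb s).
rewrite !(vcomb_cat, vcomb_opp, vcomb1, mcomb_cat, mcomb_opp, mcomb1) !tact1.
rewrite s0 -sE oppr0 addr0 addrA subrr.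
by move=> /(_ erefl)/eqP; rewrite subr_eq0 => /eqP.
Qed.

Lemma dom_quot_generated : generated K dom_quot.
Proof.
exists (M * nat)%type, (mk_tlin (quot_pi_tlin relations_act)) => q.
by exists (repr q); apply: reprK.
Qed.

End Embedding.

(** Domination holds in direct sums of copies of [K], passes to images and is reflected by
    injections; conversely, chosen witnesses feed [dom_embed]. *)
Lemma subgeneratedP (A : pzRingType) (T : aring A) (K M : tmod T) :
  subgenerated K M <-> forall x : M, x \in dominated K M.
Proof.
split=> [[N [i [[I [p p_surj]] i_inj]]] x|domM].
  apply: (dominated_inj i_inj); have [f <-] := p_surj (i x).
  exact/dominated_tlin/dominated_dsum.
have /choice[k kP] : forall x : M, exists s : seq K,
    forall t : T, (forall y, y \in s -> y <-| t = 0) -> x <-| t = 0.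
  by move=> x; apply/asboolP/domM.
exists (dom_quot k), (mk_tlin (dom_embed_tlin k)); split.
  exact: dom_quot_generated.
exact: dom_embed_inj.
Qed.

(** * The trace as coreflection onto [K]-subgenerated modules *)

Lemma Sp_subgenerated (A : pzRingType) (T : aring A) (K M : tmod T) :
  subgenerated K (Sp K M).
Proof.
apply/subgeneratedP => x.
have val_tlin : is_tlin (fun y : Sp K M => Sp_val y) by [].
apply: (dominated_inj (f := mk_tlin val_tlin)); first exact: val_inj.
(* Each summand [f n] is dominated because [n] is. *)
case: x => /= _ /asboolP[s [hs ->]]; rewrite big_seq; apply: rpred_sum => y ys.
have [N [f [n [KN ->]]]] := hs y ys.
by apply: dominated_tlin; move/subgeneratedP: KN; apply.
Qed.

Lemma Sp_pred_tlin (A : pzRingType) (T : aring A) (K M N : tmod T)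
    (f : tlin M N) (x : M) :
  subgenerated K M -> f x \in Sp_pred K (M := N).
Proof.
move=> KM; apply/asboolP; exists [:: f x]; rewrite big_seq1; split=> // y.
by rewrite inE => /eqP ->; exists M, f, x.
Qed.

Section Corestrict.
Variables (A : pzRingType) (T : aring A) (K M P : tmod T).
Hypothesis (KM : subgenerated K M).

Lemma corestrict_tlin (f : tlin M P) :
  is_tlin (fun m => SpElt (Sp_pred_tlin f m KM) : Sp K P).
Proof.
split=> [x y|x t]; apply: val_inj => /=; first exact: tlin_additive.
exact: tlin_act.
Qed.

Definition corestrict (f : tlin M P) : tlin M (Sp K P) :=
  mk_tlin (corestrict_tlin f).

Lemma Sp_val_tlin : is_tlin (fun x : Sp K P => Sp_val x).
Proof. by []. Qed.

(** The inverse composes with the inclusion of [Sp K P] in [P]. *)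
Lemma corestrict_bij : bijective corestrict.
Proof.
exists (tlin_comp (mk_tlin Sp_val_tlin)) => f; apply: tlin_ext => x //.
exact: val_inj.
Qed.

End Corestrict.

(** * Induction along [xi] and subgeneration *)

Section Adjunction.
Variables (A B : pzRingType) (beta : {rmorphism A -> B}).
Variables (T : aring A) (S : aring B).
Variable xi : aring_morphism (restr_aring beta S) T.
Variable ind : induced_action xi.

Lemma induced_actE (M : tmod T) (m : M) (b : B) (s : S) :
  (tens_elt beta m b : induced ind M) <-| s = tens_elt beta (m <-| xi s) b.
Proof. exact: ind_actE. Qed.

Section Retraction.
Variable M : tmod T.

(* M is a right B-module through B -> S -> T, and this is m (x) b |-> m b.    *)
Definition retr : tensB beta M -> M :=
  tensor_lift (fun (m : und M) (b : along beta) =>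
    (m : M) <-| xi (aunit S (b : B)) : M).

(** Since [xi] preserves units, [beta a] acts on [M] through [S] as [a] does through [T]. *)
Lemma retr_balanced : is_balanced (fun (m : und M) (b : along beta) =>
  (m : M) <-| xi (aunit S (b : B)) : M).
Proof.
split=> [m m' b|m b b'|m a b].
- exact: tactDl.
- rewrite -(ractionDr (tactP M)); congr (_ <-| _).
  by rewrite (bilinD (aunit_bilin S)) (bilinD (amor_bilin xi)).
- rewrite und_ractE tactA -(amor1 xi) -amorM; congr (_ <-| xi _).
  rewrite [LHS]restr_mulE [LHS]amul1l along_scaleE.
  by rewrite -(bilinZl (aunit_bilin S)).
Qed.

Lemma retr1 (m : M) : retr (tens_elt beta m 1) = m.
Proof.
rewrite [LHS](tensor_liftE retr_balanced) -[RHS]tact1 -(amor1 xi).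
by congr (_ <-| xi _); rewrite /= /restr_unit rmorph1.
Qed.

Lemma tens_elt1_inj : injective (fun m : M => tens_elt beta m 1).
Proof. exact: can_inj retr1. Qed.

End Retraction.

Lemma tens_elt_additive (M : tmod T) (b : B) :
  is_additive (fun m : M => tens_elt beta m b).
Proof. by move=> m m'; apply: tensDl. Qed.

(** Only pure tensors [m (x) b] need a witness: concatenate, over the [k] in a list dominating [m],
    witnesses in [L] for [k (x) 1]. *)
Lemma induced_subgenerated (K M : tmod T) (L : tmod S) :
  subgenerated L (induced ind K) -> subgenerated K M ->
  subgenerated L (induced ind M).
Proof.
move=> /subgeneratedP KL /subgeneratedP KM; apply/subgeneratedP => z.
apply: (tensor_ind (dominated_closed L (induced ind M))) => m b.
rewrite -/(tens_elt beta (m : M) b).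
have /asboolP[s hs] := KM m.
have [l hl] : exists l : seq L, forall u : S,
    (forall y, y \in l -> y <-| u = 0) ->
    forall k, k \in s -> k <-| xi u = 0.
  elim: s {hs} => [|k s [l hl]]; first by exists [::].
  have /asboolP[l' hl'] := KL (tens_elt beta k 1).
  exists (l' ++ l) => u hu k'; rewrite inE => /orP[/eqP ->|]; last first.
    by apply: hl => y yl; apply: hu; rewrite mem_cat yl orbT.
  (* If [u] kills [k (x) 1], then [k xi(u) (x) 1] is zero, and [retr] recovers [k xi(u) = 0]. *)
  apply: tens_elt1_inj; rewrite (is_additive0 (@tens_elt_additive K 1)).
  rewrite -induced_actE; apply: hl' => y yl; apply: hu; rewrite mem_cat yl //.
apply/asboolP; exists l => u /hl/hs mu.
by rewrite induced_actE mu (is_additive0 (@tens_elt_additive M b)).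
Qed.

Lemma induced_ext (M : tmod T) (N : tmod S) (f g : tlin (induced ind M) N) :
  (forall (m : M) (b : B), f (tens_elt beta m b) = g (tens_elt beta m b)) ->
  f = g.
Proof.
move=> fg; apply: tlin_ext.
exact: (tensor_ext (tlin_additive f) (tlin_additive g)).
Qed.

(** * Transposition between induction and Hom *)

Section Transpose.
Variables (M : tmod T) (N : tmod S).

Lemma orbit_tlin (m : M) : is_tlin (fun t : regular T => m <-| (t : T)).
Proof. by split=> [t u|t u]; [exact: tact_additiver | rewrite tactA]. Qed.

(** Inducing the orbit map [t |-> m t] makes [S]-linearity automatic. *)
Definition transpose_fun (h : tlin (induced ind M) N) (m : M) : hom_mod ind N :=
  tlin_comp h (mk_tlin (induced_funP ind (mk_tlin (orbit_tlin m)))).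

Lemma transpose_funE (h : tlin (induced ind M) N) (m : M) (t : T) (b : B) :
  transpose_fun h m (tens_elt beta (t : regular T) b) =
  h (tens_elt beta (m <-| t) b).
Proof. by rewrite /= induced_funE. Qed.

Lemma transpose_tlin (h : tlin (induced ind M) N) : is_tlin (transpose_fun h).
Proof.
split=> [m m'|m t]; apply: induced_ext => u b.
- rewrite -[RHS]/(transpose_fun h m (tens_elt beta u b) +
    transpose_fun h m' (tens_elt beta u b)) !transpose_funE.
  by rewrite tactDl tens_elt_additive; apply: tlin_additive.
- by rewrite transpose_funE [RHS]hom_actE transpose_funE tactA.
Qed.

Definition transpose (h : tlin (induced ind M) N) : tlin M (hom_mod ind N) :=
  mk_tlin (transpose_tlin h).

Section Untranspose.
Variable g : tlin M (hom_mod ind N).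

Let eval (m : und M) (b : along beta) : N :=
  (g (m : M) : tlin _ _) (tens_elt beta (aunit T 1 : regular T) (b : B)).

(** Balancing reads [g (m a) (1 (x) b) = g m (a (x) b) = g m (1 (x) a b)], with [a] mapped into [T]
    by its unit. *)
Let eval_balanced : is_balanced eval.
Proof.
split=> [m m' b|m b b'|m a b].
- by rewrite /eval tlin_additive.
- rewrite /eval -(tlin_additive (g (m : M))); congr (tfun _ _).
  exact: tensDr.
- rewrite /eval und_ractE tlin_act [LHS]hom_actE amul1r ract1.
  congr (tfun _ _); rewrite /tens_elt -tensA; congr tens.
  by rewrite und_ractE /= amul1l scale1r.
Qed.

Definition untranspose_fun : induced ind M -> N := tensor_lift eval.

Lemma untranspose_funE (m : M) (b : B) : untranspose_fun (tens_elt beta m b) =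
  (g m : tlin _ _) (tens_elt beta (aunit T 1 : regular T) b).
Proof. exact: (tensor_liftE eval_balanced). Qed.

Lemma untranspose_tlin : is_tlin untranspose_fun.
Proof.
have uD : is_additive untranspose_fun.
  exact: tensor_lift_additive eval_balanced.
split=> // x s.
apply: (tensor_ext
  (f := fun x : tensB beta M => untranspose_fun ((x : induced ind M) <-| s))
  (g := fun x : tensB beta M => untranspose_fun x <-| s)) => [y z|y z|m b].
- by rewrite -uD; congr untranspose_fun; apply: tactDl.
- by rewrite -tactDl; congr tact; apply: uD.
- rewrite -/(tens_elt beta (m : M) b) induced_actE !untranspose_funE.
  (* Linearity of [g] moves [xi s] into the argument, where it is the action of [s] on [1 (x) b]. *)
  rewrite tlin_act [LHS]hom_actE -tlin_act induced_actE.
  congr (tfun _ _); congr tens.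
  by rewrite /= amul1l amul1r scale1r ract1.
Qed.

Definition untranspose : tlin (induced ind M) N := mk_tlin untranspose_tlin.

End Untranspose.

Lemma transposeK : cancel transpose untranspose.
Proof.
move=> h; apply: induced_ext => m b.
by rewrite [LHS]untranspose_funE [LHS]transpose_funE tact1.
Qed.

(** Linearity of [g] gives [g (m t) (1 (x) b) = g m (t (x) b)]. *)
Lemma untransposeK : cancel untranspose transpose.
Proof.
move=> g; apply: tlin_ext => m; apply: induced_ext => t b.
rewrite [LHS]transpose_funE [LHS]untranspose_funE tlin_act [LHS]hom_actE.
by rewrite amul1r ract1.
Qed.

End Transpose.

End Adjunction.

Theorem theorem3p6 (R : comNzRingType) (A B : ualgType R)
    (beta : {rmorphism A -> B})
    (betaZ : forall (r : R) (a : A), beta (ascale r a) = ascale r (beta a))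
    (T : aring A) (S : aring B)
    (xi : aring_morphism (restr_aring beta S) T)
    (ind : induced_action xi)
    (K : tmod T) (L : tmod S)
    (KL : subgenerated L (induced ind K)) :
  exists (indP : forall M : ModCat T,
            subgenerated K M -> subgenerated L (induced_functor ind M))
         (coindP : forall N : ModCat S,
            subgenerated L N -> subgenerated K (Coind ind K N)),
    adjoint_pair (restrict_functor indP) (restrict_functor coindP).
Proof.
exists (fun M KM => induced_subgenerated KL KM).
exists (fun N _ => Sp_subgenerated K (hom_mod ind N)).
exists (fun X Y h => corestrict (svalP X) (transpose h)).
split=> [X Y|X X' Y h f|X Y Y' g h].
(* Transposition is followed by the universal property of the trace. *)
- apply: bij_comp (corestrict_bij _ _) _.
  by exists (@untranspose _ _ _ _ _ _ ind (sval X) (sval Y));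
    [exact: transposeK | exact: untransposeK].
(* On [t (x) b] the two sides are the values of [h] at [f (m t) (x) b] and [(f m) t (x) b]. *)
- apply: tlin_ext => m; apply: val_inj; apply: induced_ext => t b.
  rewrite [LHS]transpose_funE [RHS]transpose_funE /= induced_funE.
  by rewrite tlin_act.
- apply: tlin_ext => m; apply: val_inj; apply: induced_ext => t b.
  by [].
Qed.
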